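(* Let $X$ be a smooth complex projective variety of complex dimension $m$ and let $n\ge 2$. Then for every integer $k\in[(n-1)(2m-1),\,n(2m-1)+1]$ the top differential of the Kriz model $$d:E_{n-1}^k(X,n)\longrightarrow E_{n-2}^{k+1}(X,n)$$ is injective.
   Context: $X$ is connected of complex dimension $m\ge 1$; $H^*(X)=H^*(X;\mathbb{Q})$; $w\in H^{2m}(X)$ is the fundamental class; $\Delta=w\otimes 1+\dots+1\otimes w\in H^*(X)\otimes H^*(X)\cong H^*(X^2)$ is the class of the diagonal. For $1\le i\ne j\le n$, $p_i^*:H^*(X)\to H^*(X^n)$ and $p_{ij}^*:H^*(X^2)\to H^*(X^n)$ are the pullbacks along the projections $X^n\to X$ and $X^n\to X^2$ to the $i$-th, resp. $(i,j)$-th, factors. The Kriz model $E(X,n)$ is the graded-commutative algebra obtained from the exterior algebra with generators $G_{ij}$ ($1\le i\neq j\le n$), of degree $2m-1$, and coefficients in $H^*(X)^{\otimes n}=H^*(X^n)$, modulo the relations $$G_{ji}=G_{ij};\qquad p_j^*(x)G_{ij}=p_i^*(x)G_{ij}\ (i<j,\ x\in H^*(X));\qquad G_{ik}G_{jk}=G_{ij}G_{jk}-G_{ij}G_{ik}\ (i<j<k).$$ The differential $d$ is the derivation with $d|_{H^*(X)^{\otimes n}}=0$ and $d(G_{ij})=p_{ij}^*(\Delta)$. The model is bigraded, $E(X,n)=\bigoplus_{k,q}E_q^k(X,n)$, where the lower (exterior) degree $q$ is the number of exterior generators $G_{ij}$ and the upper degree $k$ is the total degree; $d:E_q^k\to E_{q-1}^{k+1}$.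 *)

(* Defs.v *)
From HB Require Import structures.
From mathcomp Require Import all_boot all_order all_algebra all_field.
From mathcomp Require Import generic_quotient.
From mathcomp Require Import boolp.

Set Implicit Arguments.
Unset Strict Implicit.
Unset Printing Implicit Defensive.

Import GRing.Theory.
Local Open Scope ring_scope.
Local Open Scope quotient_scope.

(* The structure carried by H^*(X; Q), for X a connected smooth complex
   projective variety of complex dimension m: a finite-dimensional rational
   algebra, graded in degrees 0, ..., 2m and commutative in the graded sense,
   with H^0 = Q (connectedness), H^2m = Q w, and whose cup product
   H^k x H^(2m - k) -> H^2m is a perfect pairing (Poincare duality).
   Odd degrees are allowed, so the underlying ring need not be commutative. *)
Record poincareAlg (m : nat) := PoincareAlg {
  coh_sort :> falgType rat;
  coh_gr : nat -> {vspace coh_sort};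
  coh_fund : coh_sort;
  coh_gr_direct : directv (\sum_(k < (2 * m).+1) coh_gr k)%VS;
  coh_gr_full : (\sum_(k < (2 * m).+1) coh_gr k)%VS = fullv;
  coh_gr_gt : forall k, (2 * m < k)%N -> coh_gr k = 0%VS;
  coh_gr0 : coh_gr 0 = <[1]>%VS;
  coh_gr_top : coh_gr (2 * m) = <[coh_fund]>%VS;
  coh_fund_neq0 : coh_fund != 0;
  coh_mul_gr : forall k l x y,
    x \in coh_gr k -> y \in coh_gr l -> x * y \in coh_gr (k + l);
  coh_mulC : forall k l x y,
    x \in coh_gr k -> y \in coh_gr l -> x * y = (-1) ^+ (k * l) *: (y * x);
  coh_duality : forall k x, (k <= 2 * m)%N -> x \in coh_gr k -> x != 0 ->
    exists2 y, y \in coh_gr (2 * m - k) & x * y = coh_fund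
}.

Section Cohomology.
Context (m : nat) (H : poincareAlg m).
Local Notation w := (coh_fund H).
Local Notation gr := (coh_gr H).
Local Notation top := ((2 * m).+1).

Definition coh_proj (k : 'I_top) : 'End(H) :=
  sumv_pi (\sum_(j < top) gr j)%VS k.

(* The integral over X: the coefficient of w in the degree 2m component. *)
Definition coh_int (x : H) : rat := coord [tuple w] ord0 (coh_proj ord_max x).

(* The parity involution x |-> (-1)^|x| x. *)
Definition coh_parity (x : H) : H := \sum_(k < top) (-1) ^+ k *: coh_proj k x.

Definition coh_dim : nat := \dim {:H}.

Definition coh_basis (a : 'I_coh_dim) : H := (vbasis {:H})`_a.

Definition coh_gram : 'M[rat]_coh_dim :=
  \matrix_(a, b) coh_int (coh_basis a * coh_basis b).

(* The dual basis: coh_int (coh_basis a * coh_dual b) = (a == b)%:R; see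
   coh_dualP. *)
Definition coh_dual (b : 'I_coh_dim) : H :=
  \sum_c invmx coh_gram c b *: coh_basis c.

Lemma sum_proj x : \sum_(k < top) coh_proj k x = x.
Proof.
by apply: sumv_pi_sum; rewrite coh_gr_full memvf.
Qed.

Lemma mem_proj k x : coh_proj k x \in gr k.
Proof. exact: memv_sum_pi. Qed.

Lemma proj_gr (j : 'I_top) k x : x \in gr k ->
  coh_proj j x = if j == k :> nat then x else 0.
Proof.
move=> xk.
have [k_le|k_gt] := ltnP k top; last first.
  move: xk; rewrite coh_gr_gt // memv0 => /eqP->.
  by rewrite linear0 if_same.
have /directv_sum_unique dx := coh_gr_direct H.
pose v (j : 'I_top) : H := if j == k :> nat then x else 0.
have vP i : true -> v i \in gr i.
  by move=> _; rewrite /v; case: eqP => [->|_] //; rewrite mem0v.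
have := dx (fun j => coh_proj j x) v (fun j _ => mem_proj j x) vP.
rewrite sum_proj /v (bigD1 (Ordinal k_le)) //= eqxx big1 => [|i ne]; last first.
  by rewrite (_ : (_ == _) = false) //; apply: negbTE.
by rewrite addr0 eqxx => /esym/forall_inP/(_ j isT)/eqP.
Qed.

Lemma gr_ind (P : H -> Prop) : (forall x y, P x -> P y -> P (x + y)) ->
  (forall k x, x \in gr k -> P x) -> forall x, P x.
Proof.
move=> PD Pk x; rewrite -(sum_proj x); apply: (big_ind P) => //.
  by apply: (Pk 0%N); rewrite mem0v.
by move=> i _; apply/Pk/mem_proj.
Qed.

Fact parity_linear : linear coh_parity.
Proof.
move=> a x y; rewrite /coh_parity scaler_sumr -big_split /=.
by apply: eq_bigr => k _; rewrite linearP scalerDr !scalerA mulrC.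
Qed.
HB.instance Definition _ :=
  GRing.isLinear.Build rat H H _ coh_parity parity_linear.

Fact int_linear : linear_for *%R coh_int.
Proof. by move=> a x y; rewrite /coh_int !linearP. Qed.
HB.instance Definition _ :=
  GRing.isLinear.Build rat H rat _ coh_int int_linear.

Lemma parity_gr k x : x \in gr k -> coh_parity x = (-1) ^+ k *: x.
Proof.
move=> xk; rewrite /coh_parity.
transitivity (\sum_(j < top) (-1 : rat) ^+ k *: coh_proj j x); last first.
  by rewrite -scaler_sumr sum_proj.
apply: eq_bigr => j _; rewrite (proj_gr _ xk).
by case: eqP => [->|_] //; rewrite !scaler0.
Qed.

Lemma mem_1 : 1 \in gr 0.
Proof. by rewrite coh_gr0 memv_line. Qed.

Lemma parity1 : coh_parity 1 = 1.
Proof. by rewrite (parity_gr mem_1) scale1r. Qed.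

Lemma parityM x y : coh_parity (x * y) = coh_parity x * coh_parity y.
Proof.
move: x; apply: gr_ind => [x x' hx hx'|k x xk].
  by rewrite mulrDl !linearD /= hx hx' mulrDl.
move: y; apply: gr_ind => [y y' hy hy'|l y yl].
  by rewrite mulrDr !linearD /= hy hy' mulrDr.
rewrite (parity_gr (coh_mul_gr xk yl)) (parity_gr xk) (parity_gr yl).
by rewrite -scalerAl -scalerAr scalerA exprD.
Qed.

Lemma mem_parity k x : x \in gr k -> coh_parity x \in gr k.
Proof. by move=> xk; rewrite (parity_gr xk) memvZ. Qed.

Lemma parityK : involutive coh_parity.
Proof.
apply: gr_ind => [x y hx hy|k x xk]; first by rewrite !linearD /= hx hy.
rewrite (parity_gr (mem_parity xk)) (parity_gr xk) scalerA.
by rewrite -exprD addnn -mul2n exprM sqrrN !expr1n scale1r.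
Qed.

Lemma int_fund : coh_int w = 1.
Proof.
have wt : w \in gr (2 * m) by rewrite coh_gr_top memv_line.
have pw : coh_proj ord_max w = w by rewrite (proj_gr _ wt) /= eqxx.
have fw : free [tuple w] by rewrite seq1_free coh_fund_neq0.
rewrite /coh_int pw.
exact: (coord_free (@ord0 0) (@ord0 0) fw).
Qed.

Lemma int_gr k x : x \in gr k -> k != (2 * m)%N -> coh_int x = 0.
Proof.
move=> xk ne; rewrite /coh_int (proj_gr _ xk) /= eq_sym.
by rewrite (negbTE ne) linear0.
Qed.

Lemma intC x y : coh_int (x * y) = coh_int (y * coh_parity x).
Proof.
move: x; apply: gr_ind => [x x' hx hx'|k x xk].
  by rewrite mulrDl !linearD /= hx hx' mulrDr linearD.
move: y; apply: gr_ind => [y y' hy hy'|l y yl].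
  by rewrite mulrDr !linearD /= hy hy' mulrDl linearD.
rewrite (parity_gr xk) -scalerAr (coh_mulC xk yl) !linearZ /=.
have [e|ne] := eqVneq (l + k)%N (2 * m)%N; last first.
  by rewrite (int_gr (coh_mul_gr yl xk) ne) !mulr0.
congr (_ * _); rewrite -signr_odd -[RHS]signr_odd; congr (_ ^+ nat_of_bool _).
have := congr1 odd e; rewrite oddD !oddM /=.
by case: (odd l) (odd k) => [] [].
Qed.

Lemma int_nondegl x : (forall y, coh_int (x * y) = 0) -> x = 0.
Proof.
move=> x0; rewrite -(sum_proj x); apply: big1 => k _.
apply/eqP/negPn/negP => nz.
have [|y yl e] := coh_duality _ (mem_proj k x) nz; first by rewrite -ltnS.
have := x0 y; rewrite -(sum_proj x) mulr_suml linear_sum (bigD1 k) //= e int_fund.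
rewrite big1 => [/eqP|j ne]; first by rewrite addr0 oner_eq0.
apply: (int_gr (coh_mul_gr (mem_proj j x) yl)); apply: contra ne => /eqP e'.
apply/eqP/val_inj => /=; have := ltn_ord k; rewrite ltnS => lek.
by apply/eqP; rewrite -(eqn_add2r (2 * m - k)%N) e' subnKC.
Qed.

Lemma int_nondegr y : (forall x, coh_int (x * y) = 0) -> y = 0.
Proof.
by move=> y0; apply: int_nondegl => x; rewrite -[x]parityK -intC y0.
Qed.

Lemma basis_sum x : {c : 'I_coh_dim -> rat | x = \sum_a c a *: coh_basis a}.
Proof.
exists (fun a => coord (vbasis {:H}) a x).
by rewrite {1}(coord_vbasis (memvf x)).
Qed.

Lemma gram_unit : coh_gram \in unitmx.
Proof.
rewrite -row_free_unit -kermx_eq0; apply/rowV0P => v /sub_kermxP vG.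
pose x := \sum_a v 0 a *: coh_basis a.
have x0 : x = 0.
  apply: int_nondegl => y; have [c ->] := basis_sum y.
  rewrite mulr_sumr linear_sum big1 //= => b _.
  rewrite -scalerAr linearZ /= mulr_suml linear_sum /=.
  rewrite -[RHS](mulr0 (c b)); congr (_ * _).
  transitivity ((v *m coh_gram) 0 b); last by rewrite vG mxE.
  rewrite mxE; apply: eq_bigr => a _.
  by rewrite -scalerAl linearZ /= mxE.
have /freeP h : free (vbasis {:H}) by exact: basis_free (vbasisP _).
by apply/rowP => a; rewrite mxE; apply: (h (fun a => v 0 a)).
Qed.

Lemma coh_dualP a b : coh_int (coh_basis a * coh_dual b) = (a == b)%:R.
Proof.
rewrite mulr_sumr linear_sum /=.
transitivity ((coh_gram *m invmx coh_gram) a b).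
  rewrite mxE; apply: eq_bigr => c _.
  by rewrite -scalerAr linearZ /= mxE mulrC.
by rewrite mulmxV ?gram_unit // mxE.
Qed.

Lemma basis_expand x : x = \sum_a coh_int (x * coh_dual a) *: coh_basis a.
Proof.
have [c ex] := basis_sum x; rewrite [LHS]ex; apply: eq_bigr => a _.
congr (_ *: _); rewrite ex mulr_suml linear_sum (bigD1 a) //= big1 => [|b ne].
  by rewrite -scalerAl linearZ /= coh_dualP eqxx mulr1 addr0.
by rewrite -scalerAl linearZ /= coh_dualP (negbTE ne) mulr0.
Qed.

Lemma dual_expand y : y = \sum_a coh_int (coh_basis a * y) *: coh_dual a.
Proof.
apply/eqP; rewrite -subr_eq0; apply/eqP/int_nondegr => x.
have [c ->] := basis_sum x.
rewrite mulr_suml linear_sum big1 //= => b _.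
rewrite -scalerAl linearZ mulrBr linearB /= mulr_sumr linear_sum /=.
rewrite (bigD1 b) //= big1 => [|a ne].
  by rewrite -scalerAr linearZ /= coh_dualP eqxx mulr1 addr0 subrr mulr0.
by rewrite -scalerAr linearZ /= coh_dualP eq_sym (negbTE ne) mulr0.
Qed.

Fact linear_comb (V : lmodType rat) (f : H -> V) I (r : seq I) c v :
  linear f -> f (\sum_(a <- r) c a *: v a) = \sum_(a <- r) c a *: f (v a).
Proof.
move=> lf; pose g := HB.pack_for {linear H -> V} f
  (GRing.isLinear.Build rat H V _ f lf).
rewrite -[f]/(g : H -> V) linear_sum.
by apply: eq_bigr => a _; rewrite linearZ.
Qed.

Lemma dual_adjoint (V : lmodType rat) (F : H -> H -> V) (S T : H -> H) :
  (forall y, linear (F^~ y)) -> (forall x, linear (F x)) ->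
  (forall x y, coh_int (S x * y) = coh_int (x * T y)) ->
  \sum_a F (coh_dual a) (S (coh_basis a)) =
  \sum_a F (T (coh_dual a)) (coh_basis a).
Proof.
move=> Fl Fr adj.
under eq_bigr => a _ do
  rewrite (basis_expand (S (coh_basis a))) (linear_comb _ _ _ (Fr _)).
rewrite exchange_big /=; apply: eq_bigr => b _.
rewrite [in RHS](dual_expand (T (coh_dual b))) (linear_comb _ _ _ (Fl _)).
by apply: eq_bigr => a _; rewrite adj.
Qed.

Lemma int_parity x y : coh_int (coh_parity x * y) = coh_int (x * coh_parity y).
Proof. by rewrite intC parityK intC. Qed.

End Cohomology.

Section KrizModel.
Context (m : nat) (H : poincareAlg m) (n : nat).
Local Notation gr := (coh_gr H).

(* The Kriz model is the rational algebra with generators kP i x = p_i^*(x), for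
   x in H^*(X), and kG i j = G_ij, for i != j: the quotient of the terms by the
   smallest congruence that contains the axioms of unital associative algebras
   (up to krel_ZMr) and the following relations.
   - krel_PD, krel_PZ, krel_P1, krel_PM, krel_PC present the graded tensor power
     of n copies of H^*(X), with p_i^*(x) standing for x in the i-th factor;
   - krel_PG, krel_GG, krel_G2 make the G_ij, of odd degree, generate an exterior
     algebra over it, with Koszul signs;
   - krel_Gsym, krel_coef, krel_arnold are the relations between the G_ij. *)
Inductive kriz_term : Type :=
  | k0
  | k1
  | kN of kriz_term
  | kD of kriz_term & kriz_term
  | kZ of rat & kriz_term
  | kM of kriz_term & kriz_term
  | kP of 'I_n & H
  | kG (i j : 'I_n) of i != j.

Reserved Notation "t ~ u" (at level 70).
Local Notation "a %+ b" := (kD a b) (at level 50, left associativity).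
Local Notation "a %* b" := (kM a b) (at level 40, left associativity).

Inductive kriz_rel : kriz_term -> kriz_term -> Prop :=
  | krel_refl t : t ~ t
  | krel_sym t u : t ~ u -> u ~ t
  | krel_trans t u v : t ~ u -> u ~ v -> t ~ v
  | krel_N t t' : t ~ t' -> kN t ~ kN t'
  | krel_D t t' u u' : t ~ t' -> u ~ u' -> t %+ u ~ t' %+ u'
  | krel_Z c t t' : t ~ t' -> kZ c t ~ kZ c t'
  | krel_M t t' u u' : t ~ t' -> u ~ u' -> t %* u ~ t' %* u'
  | krel_DA t u v : t %+ (u %+ v) ~ (t %+ u) %+ v
  | krel_DC t u : t %+ u ~ u %+ t
  | krel_D0 t : k0 %+ t ~ t
  | krel_DN t : kN t %+ t ~ k0
  | krel_MA t u v : t %* (u %* v) ~ (t %* u) %* v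
  | krel_1M t : k1 %* t ~ t
  | krel_M1 t : t %* k1 ~ t
  | krel_MDl t u v : (t %+ u) %* v ~ (t %* v) %+ (u %* v)
  | krel_MDr t u v : t %* (u %+ v) ~ (t %* u) %+ (t %* v)
  | krel_ZA b c t : kZ b (kZ c t) ~ kZ (b * c) t
  | krel_Z1 t : kZ 1 t ~ t
  | krel_ZDr c t u : kZ c (t %+ u) ~ kZ c t %+ kZ c u
  | krel_ZDl b c t : kZ (b + c) t ~ kZ b t %+ kZ c t
  | krel_ZMl c t u : kZ c (t %* u) ~ kZ c t %* u
  | krel_ZMr c t u : kZ c (t %* u) ~ t %* kZ c u
  | krel_PD i x y : kP i (x + y) ~ kP i x %+ kP i y
  | krel_PZ c i x : kP i (c *: x) ~ kZ c (kP i x)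
  | krel_P1 i : kP i 1 ~ k1
  | krel_PM i x y : kP i (x * y) ~ kP i x %* kP i y
  | krel_PC i j k l x y : i != j -> x \in gr k -> y \in gr l ->
      kP i x %* kP j y ~ kZ ((-1) ^+ (k * l)) (kP j y %* kP i x)
  | krel_PG l i j ij k x : x \in gr k ->
      kP l x %* @kG i j ij ~ kZ ((-1) ^+ k) (@kG i j ij %* kP l x)
  | krel_GG i j ij k l kl :
      @kG i j ij %* @kG k l kl ~ kN (@kG k l kl %* @kG i j ij)
  | krel_G2 i j ij : @kG i j ij %* @kG i j ij ~ k0
  | krel_Gsym i j ij ji : @kG j i ji ~ @kG i j ij
  | krel_coef (i j : 'I_n) ij x : (i < j)%N ->
      kP j x %* @kG i j ij ~ kP i x %* @kG i j ij
  | krel_arnold (i j k : 'I_n) ij jk ik : (i < j)%N -> (j < k)%N ->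
      @kG i k ik %* @kG j k jk ~
      @kG i j ij %* @kG j k jk %+ kN (@kG i j ij %* @kG i k ik)
where "t ~ u" := (kriz_rel t u).

HB.instance Definition _ := gen_eqMixin kriz_term.
HB.instance Definition _ := gen_choiceMixin kriz_term.

Definition kriz_relb (t u : kriz_term) : bool := `[< kriz_rel t u >].

Fact kriz_relb_equiv : equiv_class_of kriz_relb.
Proof.
split=> [t|t u|u t v].
- by apply/asboolP; apply: krel_refl.
- by apply/asboolP/asboolP; apply: krel_sym.
- by move=> /asboolP tu /asboolP uv; apply/asboolP; apply: krel_trans uv.
Qed.
Canonical kriz_equiv := EquivRelPack kriz_relb_equiv.

Definition kriz := {eq_quot kriz_equiv}.
HB.instance Definition _ := Choice.on kriz.
HB.instance Definition _ := EqQuotient.on kriz.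

Lemma kriz_piP t u : \pi_kriz t = \pi_kriz u <-> kriz_rel t u.
Proof.
by split=> [/eqmodP/asboolP//|tu]; apply/eqmodP/asboolP.
Qed.

Local Notation pi := (\pi_kriz).
Definition kriz_add (a b : kriz) : kriz := pi (kD (repr a) (repr b)).
Definition kriz_opp (a : kriz) : kriz := pi (kN (repr a)).
Definition kriz_mul (a b : kriz) : kriz := pi (kM (repr a) (repr b)).
Definition kriz_scale c (a : kriz) : kriz := pi (kZ c (repr a)).

Fact repr_rel t : kriz_rel (repr (pi t)) t.
Proof. by apply/kriz_piP; rewrite reprK. Qed.

Lemma pi_D t u : pi (kD t u) = kriz_add (pi t) (pi u).
Proof. by apply/kriz_piP/krel_sym/krel_D; apply: repr_rel. Qed.
Lemma pi_N t : pi (kN t) = kriz_opp (pi t).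
Proof. by apply/kriz_piP/krel_sym/krel_N; apply: repr_rel. Qed.
Lemma pi_M t u : pi (kM t u) = kriz_mul (pi t) (pi u).
Proof. by apply/kriz_piP/krel_sym/krel_M; apply: repr_rel. Qed.
Lemma pi_Z c t : pi (kZ c t) = kriz_scale c (pi t).
Proof. by apply/kriz_piP/krel_sym/krel_Z; apply: repr_rel. Qed.

Lemma kriz_ind (P : kriz -> Prop) : (forall t, P (pi t)) -> forall a, P a.
Proof. by move=> Pt a; rewrite -(reprK a). Qed.

Fact kriz_addA : associative kriz_add.
Proof.
elim/kriz_ind=> t; elim/kriz_ind=> u; elim/kriz_ind=> v.
by rewrite -!pi_D; apply/kriz_piP; apply: krel_DA.
Qed.
Fact kriz_addC : commutative kriz_add.
Proof.
elim/kriz_ind=> t; elim/kriz_ind=> u.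
by rewrite -!pi_D; apply/kriz_piP; apply: krel_DC.
Qed.
Fact kriz_add0 : left_id (pi k0) kriz_add.
Proof. by elim/kriz_ind=> t; rewrite -pi_D; apply/kriz_piP; apply: krel_D0. Qed.
Fact kriz_addN : left_inverse (pi k0) kriz_opp kriz_add.
Proof.
by elim/kriz_ind=> t; rewrite -pi_N -pi_D; apply/kriz_piP; apply: krel_DN.
Qed.
HB.instance Definition _ :=
  GRing.isZmodule.Build kriz kriz_addA kriz_addC kriz_add0 kriz_addN.

Fact kriz_mulA : associative kriz_mul.
Proof.
elim/kriz_ind=> t; elim/kriz_ind=> u; elim/kriz_ind=> v.
by rewrite -!pi_M; apply/kriz_piP; apply: krel_MA.
Qed.
Fact kriz_mul1l : left_id (pi k1) kriz_mul.
Proof. by elim/kriz_ind=> t; rewrite -pi_M; apply/kriz_piP; apply: krel_1M. Qed.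
Fact kriz_mul1r : right_id (pi k1) kriz_mul.
Proof. by elim/kriz_ind=> t; rewrite -pi_M; apply/kriz_piP; apply: krel_M1. Qed.
Fact kriz_mulDl : left_distributive kriz_mul +%R.
Proof.
elim/kriz_ind=> t; elim/kriz_ind=> u; elim/kriz_ind=> v.
rewrite -[_ + _]pi_D -!pi_M -[_ + _]pi_D.
by apply/kriz_piP; apply: krel_MDl.
Qed.
Fact kriz_mulDr : right_distributive kriz_mul +%R.
Proof.
elim/kriz_ind=> t; elim/kriz_ind=> u; elim/kriz_ind=> v.
rewrite -[_ + _]pi_D -!pi_M -[_ + _]pi_D.
by apply/kriz_piP; apply: krel_MDr.
Qed.

Section Eval.
Context (B : pzRingType) (s : rat -> B -> B).
Context (P : 'I_n -> H -> B) (G : forall i j : 'I_n, i != j -> B).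
Fixpoint kriz_eval (t : kriz_term) : B :=
  match t with
  | k0 => 0
  | k1 => 1
  | kN t => - kriz_eval t
  | kD t u => kriz_eval t + kriz_eval u
  | kZ c t => s c (kriz_eval t)
  | kM t u => kriz_eval t * kriz_eval u
  | kP i x => P i x
  | kG i j ij => G ij
  end.
End Eval.

(* The augmentation onto H^0(X) = Q, which shows that the model is nonzero. *)
Definition coh_aug (x : H) : rat := coord [tuple (1 : H)] ord0 (coh_proj H ord0 x).

Fact coh_aug_gr k x : x \in gr k -> k != 0%N -> coh_aug x = 0.
Proof.
by move=> xk ne; rewrite /coh_aug (proj_gr _ xk) /= eq_sym (negbTE ne) linear0.
Qed.
Fact coh_aug1 : coh_aug 1 = 1.
Proof.
have f1 : free [tuple (1 : H)] by rewrite seq1_free oner_eq0.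
rewrite /coh_aug (_ : coh_proj H _ _ = 1); last by rewrite (proj_gr _ (mem_1 H)).
exact: (coord_free (@ord0 0) (@ord0 0) f1).
Qed.
Fact coh_aug_linear : linear_for *%R coh_aug.
Proof. by move=> c x y; rewrite /coh_aug !linearP. Qed.
HB.instance Definition _ :=
  GRing.isLinear.Build rat H rat _ coh_aug coh_aug_linear.
Fact coh_augM x y : coh_aug (x * y) = coh_aug x * coh_aug y.
Proof.
move: x; apply: gr_ind => [x x' hx hx'|k x xk].
  by rewrite mulrDl !linearD /= hx hx' mulrDl.
move: y; apply: gr_ind => [y y' hy hy'|l y yl].
  by rewrite mulrDr !linearD /= hy hy' mulrDr.
have [k0|nk] := eqVneq k 0%N; last first.
  by rewrite (coh_aug_gr xk) // mul0r (coh_aug_gr (coh_mul_gr xk yl)) // addn_eq0 negb_and nk.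
move: xk; rewrite k0 coh_gr0 => /vlineP[c ->].
by rewrite -scalerAl mul1r !linearZ /= coh_aug1 mulr1.
Qed.

Fact kriz_aug_rel t u : kriz_rel t u ->
  let e := @kriz_eval rat *%R (fun=> coh_aug) (fun _ _ _ => 0) in e t = e u.
Proof.
elim=> //=.
- by move=> ? ? ? _ -> _ ->.
- by move=> ? ? _ ->.
- by move=> ? ? ? ? _ -> _ ->.
- by move=> ? ? ? _ ->.
- by move=> ? ? ? ? _ -> _ ->.
- by move=> *; rewrite addrA.
- by move=> *; rewrite addrC.
- by move=> *; rewrite add0r.
- by move=> *; rewrite addNr.
- by move=> *; rewrite mulrA.
- by move=> *; rewrite mul1r.
- by move=> *; rewrite mulr1.
- by move=> *; rewrite mulrDl.
- by move=> *; rewrite mulrDr.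
- by move=> *; rewrite mulrA.
- by move=> *; rewrite mul1r.
- by move=> *; rewrite mulrDr.
- by move=> *; rewrite mulrDl.
- by move=> *; rewrite mulrA.
- by move=> *; rewrite mulrCA.
- by move=> *; rewrite linearD.
- by move=> *; rewrite linearZ.
- by rewrite coh_aug1.
- by move=> *; rewrite coh_augM.
- move=> i j k l x y _ xk yl.
  have [k0|nk] := eqVneq k 0%N; first by rewrite k0 mul0n expr0 mul1r mulrC.
  by rewrite (coh_aug_gr xk) // mul0r !mulr0.
all: by move=> *; rewrite ?(mulr0, mul0r).
Qed.

Fact kriz_1_neq0 : pi k1 != 0 :> kriz.
Proof. by apply/eqP => /kriz_piP/kriz_aug_rel /eqP; rewrite /= oner_eq0. Qed.

HB.instance Definition _ := GRing.Zmodule_isNzRing.Build kriz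
  kriz_mulA kriz_mul1l kriz_mul1r kriz_mulDl kriz_mulDr kriz_1_neq0.

Fact kriz_scaleA b c a : kriz_scale b (kriz_scale c a) = kriz_scale (b * c) a.
Proof.
elim/kriz_ind: a => t; rewrite -!pi_Z.
by apply/kriz_piP; apply: krel_ZA.
Qed.
Fact kriz_scale1 : left_id 1 kriz_scale.
Proof. by elim/kriz_ind=> t; rewrite -!pi_Z; apply/kriz_piP; apply: krel_Z1. Qed.
Fact kriz_scaleDr : right_distributive kriz_scale +%R.
Proof.
move=> c; elim/kriz_ind=> t; elim/kriz_ind=> u.
rewrite -[_ + _]pi_D -!pi_Z -[_ + _]pi_D.
by apply/kriz_piP; apply: krel_ZDr.
Qed.
Fact kriz_scaleDl a : {morph kriz_scale^~ a : b c / b + c}.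
Proof.
move=> b c; elim/kriz_ind: a => t; rewrite -!pi_Z -[RHS]pi_D.
by apply/kriz_piP; apply: krel_ZDl.
Qed.
HB.instance Definition _ := GRing.Zmodule_isLmodule.Build rat kriz
  kriz_scaleA kriz_scale1 kriz_scaleDr kriz_scaleDl.

Fact kriz_scaleAl c (a b : kriz) : c *: (a * b) = (c *: a) * b.
Proof.
elim/kriz_ind: a => t; elim/kriz_ind: b => u.
rewrite -[_ * _]pi_M -[_ *: _]pi_Z -[X in X * _]pi_Z -[_ * _]pi_M.
by apply/kriz_piP; apply: krel_ZMl.
Qed.
HB.instance Definition _ := GRing.Lmodule_isLalgebra.Build rat kriz kriz_scaleAl.
Fact kriz_scaleAr c (a b : kriz) : c *: (a * b) = a * (c *: b).
Proof.
elim/kriz_ind: a => t; elim/kriz_ind: b => u.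
rewrite -[_ * _]pi_M -[_ *: _]pi_Z -[X in _ * X]pi_Z -[_ * _]pi_M.
by apply/kriz_piP; apply: krel_ZMr.
Qed.
HB.instance Definition _ := GRing.Lalgebra_isAlgebra.Build rat kriz kriz_scaleAr.

Definition kriz_p (i : 'I_n) (x : H) : kriz := pi (kP i x).
Definition kriz_G (i j : 'I_n) (ij : i != j) : kriz := pi (kG ij).

Lemma kriz_piE :
  (pi k0 = 0) * (pi k1 = 1) *
  ((forall t, pi (kN t) = - pi t) *
   (forall t u, pi (kD t u) = pi t + pi u) *
   (forall c t, pi (kZ c t) = c *: pi t) *
   (forall t u, pi (kM t u) = pi t * pi u)) *
  ((forall i x, pi (kP i x) = kriz_p i x) *
   (forall i j (ij : i != j), pi (kG ij) = kriz_G ij)).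
Proof. by do ![split=> //]; move=> *; rewrite ?(pi_N, pi_D, pi_Z, pi_M). Qed.

Fact kriz_p_linear i : linear (kriz_p i).
Proof.
move=> c x y; transitivity (pi (kD (kZ c (kP i x)) (kP i y))); last first.
  by rewrite !kriz_piE.
apply/kriz_piP; apply: krel_trans (krel_PD _ _ _) _; apply: krel_D; last exact: krel_refl.
exact: krel_PZ.
Qed.
HB.instance Definition _ i :=
  GRing.isLinear.Build rat H kriz _ (kriz_p i) (kriz_p_linear i).

Fact kriz_p_monoid i : monoid_morphism (kriz_p i).
Proof.
split=> [|x y]; rewrite -!kriz_piE; apply/kriz_piP; first exact: krel_P1.
exact: krel_PM.
Qed.
HB.instance Definition _ i :=
  GRing.isMonoidMorphism.Build H kriz (kriz_p i) (kriz_p_monoid i).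

Lemma kriz_pC i j k l x y : i != j -> x \in gr k -> y \in gr l ->
  kriz_p i x * kriz_p j y = (-1) ^+ (k * l) *: (kriz_p j y * kriz_p i x).
Proof. by move=> ij xk yl; rewrite -!kriz_piE; apply/kriz_piP/krel_PC. Qed.
Lemma kriz_pGC l i j (ij : i != j) k x : x \in gr k ->
  kriz_p l x * kriz_G ij = (-1) ^+ k *: (kriz_G ij * kriz_p l x).
Proof. by move=> xk; rewrite -!kriz_piE; apply/kriz_piP/krel_PG. Qed.
Lemma kriz_GC i j (ij : i != j) k l (kl : k != l) :
  kriz_G ij * kriz_G kl = - (kriz_G kl * kriz_G ij).
Proof. by rewrite -!kriz_piE; apply/kriz_piP/krel_GG. Qed.
Lemma kriz_G2 i j (ij : i != j) : kriz_G ij * kriz_G ij = 0.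
Proof. by rewrite -!kriz_piE; apply/kriz_piP/krel_G2. Qed.
Lemma kriz_G_sym i j (ij : i != j) (ji : j != i) : kriz_G ji = kriz_G ij.
Proof. by rewrite -!kriz_piE; apply/kriz_piP/krel_Gsym. Qed.
Lemma kriz_coef (i j : 'I_n) (ij : i != j) x : (i < j)%N ->
  kriz_p j x * kriz_G ij = kriz_p i x * kriz_G ij.
Proof. by move=> lt; rewrite -!kriz_piE; apply/kriz_piP/krel_coef. Qed.
Lemma kriz_arnold (i j k : 'I_n) (ij : i != j) (jk : j != k) (ik : i != k) :
  (i < j)%N -> (j < k)%N ->
  kriz_G ik * kriz_G jk = kriz_G ij * kriz_G jk - kriz_G ij * kriz_G ik.
Proof. by move=> lt lt'; rewrite -!kriz_piE; apply/kriz_piP/krel_arnold. Qed.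

(* E_q^k(X, n), with q the exterior degree and k the total degree. *)
Inductive kriz_bideg : nat -> nat -> kriz -> Prop :=
  | kbideg_0 q k : kriz_bideg q k 0
  | kbideg_D q k a b :
      kriz_bideg q k a -> kriz_bideg q k b -> kriz_bideg q k (a + b)
  | kbideg_Z q k c a : kriz_bideg q k a -> kriz_bideg q k (c *: a)
  | kbideg_1 : kriz_bideg 0 0 1
  | kbideg_M q q' k k' a b : kriz_bideg q k a -> kriz_bideg q' k' b ->
      kriz_bideg (q + q') (k + k') (a * b)
  | kbideg_p i k x : x \in gr k -> kriz_bideg 0 k (kriz_p i x)
  | kbideg_G i j (ij : i != j) : kriz_bideg 1 (2 * m - 1) (kriz_G ij).

(* p_ij^*(Delta). For dual bases e_a, e_a^# of H^*(X), the class of the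
   diagonal is Delta = \sum_a (-1)^|e_a| e_a (x) e_a^# when the e_a are
   homogeneous (Milnor-Stasheff, Theorem 11.11); written with coh_parity, the
   formula does not depend on the basis, and holds for any basis. *)
Definition kriz_diag (i j : 'I_n) : kriz :=
  \sum_a kriz_p i (coh_parity (coh_basis a)) * kriz_p j (@coh_dual m H a).

(* The involution a |-> (-1)^|a| a used in the graded Leibniz rule. *)
Definition kriz_parity_term : kriz_term -> kriz :=
  @kriz_eval kriz *:%R (fun i x => kriz_p i (coh_parity x))
    (fun i j ij => - kriz_G ij).

Fixpoint kriz_d_term (t : kriz_term) : kriz :=
  match t with
  | kN t => - kriz_d_term t
  | kD t u => kriz_d_term t + kriz_d_term u
  | kZ c t => c *: kriz_d_term t
  | kM t u => kriz_d_term t * pi u + kriz_parity_term t * kriz_d_term u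
  | kG i j _ => kriz_diag i j
  | k0 | k1 | kP _ _ => 0
  end.

(* The differential. kriz_d_rel shows that it does not depend on the chosen
   representative; kriz_dM, kriz_d_p and kriz_d_G characterize it,
   and kriz_d_bideg gives its bidegree. *)
Definition kriz_d (a : kriz) : kriz := kriz_d_term (repr a).


Lemma kriz_coef_all i j (ij : i != j) x :
  kriz_p j x * kriz_G ij = kriz_p i x * kriz_G ij.
Proof.
have [lt|lt|/val_inj e] := ltngtP i j; first exact: kriz_coef.
  have ji : j != i by rewrite eq_sym.
  by rewrite -!(kriz_G_sym ij ji) kriz_coef.
by case/eqP: (ij).
Qed.

Local Notation eps k := (iter k (@coh_parity m H)).

Fact eps_linear k : linear (eps k).
Proof. by elim: k => [//|k IH] c x y /=; rewrite IH linearP. Qed.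
HB.instance Definition _ k :=
  GRing.isLinear.Build rat H H _ (iter k (@coh_parity m H)) (eps_linear k).
Fact eps_gr k l x : x \in gr l -> eps k x = (-1) ^+ (k * l) *: x.
Proof.
move=> xl; elim: k => [|k /= ->]; first by rewrite scale1r.
by rewrite linearZ /= (parity_gr xl) scalerA -exprD mulSn addnC.
Qed.
Fact epsK k : involutive (eps k).
Proof.
apply: gr_ind => [x y hx hy|l x xl]; first by rewrite !linearD /= hx hy.
rewrite (eps_gr k xl) linearZ /= (eps_gr k xl) scalerA.
by rewrite -exprD addnn -mul2n exprM sqrrN !expr1n scale1r.
Qed.
Fact epsM k x y : eps k (x * y) = eps k x * eps k y.
Proof. by elim: k => //= k ->; rewrite parityM. Qed.

Lemma kriz_p_swap i l k x y : x \in gr k ->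
  kriz_p i y * kriz_p l x = kriz_p l x * kriz_p i (eps k y).
Proof.
move=> xk; move: y; apply: gr_ind => [y y' hy hy'|r y yr].
  by rewrite !linearD mulrDl mulrDr hy hy'.
rewrite (eps_gr k yr) linearZ -scalerAr /= mulnC.
have [->|ne] := eqVneq i l; last exact: kriz_pC.
rewrite -!rmorphM /= (coh_mulC yr xk); exact: linearZ.
Qed.

Lemma kriz_p_swap' i l k x y : x \in gr k ->
  kriz_p l x * kriz_p i y = kriz_p i (eps k y) * kriz_p l x.
Proof. by move=> xk; rewrite (kriz_p_swap i l _ xk) epsK. Qed.

Lemma kriz_pG l i j (ij : i != j) x :
  kriz_p l x * kriz_G ij = kriz_G ij * kriz_p l (coh_parity x).
Proof.
move: x; apply: gr_ind => [x x' hx hx'|k x xk].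
  by rewrite !linearD mulrDl mulrDr hx hx'.
by rewrite (kriz_pGC _ _ xk) (parity_gr xk) linearZ -scalerAr.
Qed.

Lemma kriz_pp_adjoint i j (f g S T : H -> H) : linear f -> linear g ->
  (forall x y, coh_int (S x * y) = coh_int (x * T y)) ->
  \sum_a kriz_p i (f (S (coh_basis a))) * kriz_p j (g (coh_dual a)) =
  \sum_a kriz_p i (f (coh_basis a)) * kriz_p j (g (T (coh_dual a))).
Proof.
move=> lf lg adj.
apply: (@dual_adjoint _ _ _ (fun y x => kriz_p i (f x) * kriz_p j (g y))) => //.
- by move=> x c y y'; rewrite lg linearP mulrDr -scalerAr.
- by move=> y c x x'; rewrite lf linearP mulrDl -scalerAl.
Qed.

Lemma kriz_diag_eps k i j :
  \sum_a kriz_p i (eps k (coh_parity (coh_basis a))) *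
    kriz_p j (eps k (@coh_dual m H a)) = kriz_diag i j.
Proof.
elim: k => [//|k <-]; under eq_bigr => a _ do rewrite !iterSr.
rewrite -(@kriz_pp_adjoint i j (fun x => eps k (coh_parity (coh_parity x)))
  (eps k) (@coh_parity m H) (@coh_parity m H)).
- by under eq_bigr => a _ do rewrite parityK.
- by move=> c x y; rewrite !linearP.
- exact: eps_linear.
- exact: int_parity.
Qed.

Lemma kriz_diag_pC i j l x :
  kriz_diag i j * kriz_p l x = kriz_p l x * kriz_diag i j.
Proof.
move: x; apply: gr_ind => [x x' hx hx'|k x xk].
  by rewrite !linearD mulrDl mulrDr hx hx'.
rewrite -[in RHS](kriz_diag_eps k) mulr_sumr mulr_suml.
apply: eq_bigr => a _.
by rewrite -mulrA (kriz_p_swap j l _ xk) mulrA (kriz_p_swap i l _ xk) -mulrA.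
Qed.

Lemma kriz_diag_GC i j k l (kl : k != l) :
  kriz_diag i j * kriz_G kl = kriz_G kl * kriz_diag i j.
Proof.
rewrite -[in RHS](kriz_diag_eps 1) mulr_sumr mulr_suml.
by apply: eq_bigr => a _; rewrite -mulrA kriz_pG mulrA kriz_pG -mulrA.
Qed.

Lemma kriz_diag_coef i j x :
  kriz_p j x * kriz_diag i j = kriz_p i x * kriz_diag i j.
Proof.
move: x; apply: gr_ind => [x x' hx hx'|k x xk].
  by rewrite !linearD !mulrDl hx hx'.
rewrite !mulr_sumr.
transitivity (\sum_a kriz_p i (eps k (coh_parity (coh_basis a))) *
    kriz_p j (x * @coh_dual m H a)).
  apply: eq_bigr => a _.
  by rewrite mulrA (kriz_p_swap' _ _ _ xk) -mulrA -rmorphM.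
rewrite -(@kriz_pp_adjoint i j (fun y => eps k (coh_parity y)) (fun y => y)
   (fun y => y * x) (fun y => x * y)) //; first last.
- by move=> y z; rewrite mulrA.
- by move=> c y y'; rewrite !linearP.
apply: eq_bigr => a _; rewrite mulrA -rmorphM; congr (kriz_p i _ * _).
move: (coh_basis a) => e; have -> : e * x = x * eps k e.
  move: e; apply: gr_ind => [y y' hy hy'|l y yl].
    by rewrite linearD /= mulrDl mulrDr hy hy'.
  by rewrite (coh_mulC yl xk) (eps_gr k yl) -scalerAr mulnC.
rewrite parityM epsM -iterS iterSr epsK; congr (_ * _).
rewrite (parity_gr xk) linearZ /= (eps_gr k xk) scalerA -exprD.
by rewrite -signr_odd oddD oddM andbb addbb scale1r.
Qed.

Lemma int_proj (k : 'I_(2 * m).+1) (x y : H) :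
  coh_int (coh_proj H k x * y) = coh_int (x * coh_proj H (rev_ord k) y).
Proof.
move: x; apply: gr_ind => [x x' hx hx'|r x xr].
  by rewrite linearD !mulrDl !linearD /= hx hx'.
move: y; apply: gr_ind => [y y' hy hy'|l y yl].
  by rewrite linearD !mulrDr !linearD /= hy hy'.
rewrite (proj_gr _ xr) (proj_gr _ yl) /= subSS.
have [e|ne] := eqVneq (r + l)%N (2 * m)%N; last first.
  by do 2!case: ifP => _; rewrite ?mul0r ?mulr0 ?linear0 // (int_gr (coh_mul_gr xr yl) ne).
have lek : (k <= 2 * m)%N by rewrite -ltnS.
have -> : (2 * m - k == l)%N = (k == r :> nat).
  move: (nat_of_ord k) lek; rewrite -e => a lea.
  by rewrite -(eqn_add2l a) subnKC // eqn_add2r eq_sym.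
by case: ifP => _; rewrite ?mul0r ?mulr0.
Qed.

Lemma kriz_diag_sym i j : i != j -> kriz_diag j i = kriz_diag i j.
Proof.
move=> ij; transitivity (\sum_a kriz_p i (@coh_dual m H a) * kriz_p j (coh_basis a)).
  transitivity (\sum_(k < (2 * m).+1) \sum_a (-1 : rat) ^+ k *:
    (kriz_p i (eps k (@coh_dual m H a)) * kriz_p j (coh_proj H k (coh_basis a)))).
    rewrite exchange_big; apply: eq_bigr => a _.
    rewrite /coh_parity linear_sum mulr_suml; apply: eq_bigr => k _.
    by rewrite linearZ -scalerAl (kriz_p_swap' i j _ (mem_proj k _)).
  transitivity (\sum_(k < (2 * m).+1) \sum_a
    kriz_p i (coh_proj H (rev_ord k) (@coh_dual m H a)) * kriz_p j (coh_basis a)).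
    apply: eq_bigr => k _; rewrite -scaler_sumr.
    rewrite (@dual_adjoint _ _ _ (fun y x => kriz_p i (eps k y) * kriz_p j x)
      _ (coh_proj H (rev_ord k))); first last.
    - exact: int_proj.
    - by move=> y c x x'; rewrite linearP mulrDr -scalerAr.
    - by move=> x c y y'; rewrite !linearP mulrDl -scalerAl.
    rewrite scaler_sumr; apply: eq_bigr => a _.
    rewrite (eps_gr k (mem_proj _ _)) linearZ -scalerAl scalerA -exprD.
    have lek : (k <= 2 * m)%N by rewrite -ltnS.
    have /negbTE ev : ~~ odd (k + k * rev_ord k).
      by rewrite oddD oddM /= subSS oddB // oddM /=; case: (odd k).
    by rewrite -(signr_odd _ (k + _)) ev scale1r.
  rewrite exchange_big; apply: eq_bigr => a _.
  rewrite -mulr_suml -linear_sum; congr (kriz_p i _ * _).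
  by rewrite -[RHS]sum_proj [RHS](reindex_inj rev_ord_inj).
have pE l x : kriz_p l x =
    \sum_b coh_int (coh_basis b * x) *: kriz_p l (@coh_dual m H b).
  by rewrite {1}(dual_expand x) (linear_comb _ _ _ (kriz_p_linear l)).
under eq_bigr => a _ do rewrite (pE j) mulr_sumr.
rewrite exchange_big; apply: eq_bigr => b _ /=.
rewrite [in RHS]pE mulr_suml.
by apply: eq_bigr => a _; rewrite -scalerAr -scalerAl intC.
Qed.

Lemma kriz_diag_G a b c (bc : b != c) :
  kriz_diag a c * kriz_G bc = kriz_diag a b * kriz_G bc.
Proof.
rewrite !mulr_suml; apply: eq_bigr => x _.
by rewrite -mulrA kriz_coef_all mulrA.
Qed.

Fact kriz_parity_rel t u : kriz_rel t u ->
  kriz_parity_term t = kriz_parity_term u.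
Proof.
rewrite /kriz_parity_term; elim=> //=.
- by move=> ? ? ? _ -> _ ->.
- by move=> ? ? _ ->.
- by move=> ? ? ? ? _ -> _ ->.
- by move=> ? ? ? _ ->.
- by move=> ? ? ? ? _ -> _ ->.
- by move=> *; rewrite addrA.
- by move=> *; rewrite addrC.
- by move=> *; rewrite add0r.
- by move=> *; rewrite addNr.
- by move=> *; rewrite mulrA.
- by move=> *; rewrite mul1r.
- by move=> *; rewrite mulr1.
- by move=> *; rewrite mulrDl.
- by move=> *; rewrite mulrDr.
- by move=> *; rewrite scalerA.
- by move=> *; rewrite scale1r.
- by move=> *; rewrite scalerDr.
- by move=> *; rewrite scalerDl.
- by move=> *; rewrite scalerAl.
- by move=> *; rewrite scalerAr.
- by move=> *; rewrite !linearD.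
- by move=> *; rewrite !linearZ.
- by move=> i; rewrite parity1 (kriz_p_monoid i).1.
- by move=> *; rewrite parityM rmorphM.
- by move=> i j k l x y ij xk yl; apply: kriz_pC => //; apply: mem_parity.
- move=> l i j ij k x xk.
  by rewrite mulrN mulNr scalerN (kriz_pGC _ _ (mem_parity xk)).
- by move=> *; rewrite !mulrNN kriz_GC.
- by move=> *; rewrite mulrNN kriz_G2.
- by move=> i j ij ji; rewrite (kriz_G_sym ij ji).
- by move=> i j ij x lt; rewrite !mulrN kriz_coef.
- by move=> i j k ij jk ik lt lt'; rewrite !mulrNN (kriz_arnold ij).
Qed.

Lemma kriz_d_rel t u : kriz_rel t u -> kriz_d_term t = kriz_d_term u.
Proof.
elim=> //=.
- by move=> ? ? ? _ -> _ ->.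
- by move=> ? ? _ ->.
- by move=> ? ? ? ? _ -> _ ->.
- by move=> ? ? ? _ ->.
- move=> t1 t2 v v' tt' -> vv' ->.
  by rewrite (kriz_parity_rel tt') (kriz_piP v v').2.
- by move=> *; rewrite addrA.
- by move=> *; rewrite addrC.
- by move=> *; rewrite add0r.
- by move=> *; rewrite addNr.
- by move=> *; rewrite !kriz_piE mulrDl mulrDr !mulrA addrA.
- by move=> *; rewrite mul0r add0r mul1r.
- by move=> *; rewrite !kriz_piE mulr0 addr0 mulr1.
- by move=> *; rewrite !mulrDl addrACA.
- by move=> *; rewrite !kriz_piE !mulrDr addrACA.
- by move=> *; rewrite scalerA.
- by move=> *; rewrite scale1r.
- by move=> *; rewrite scalerDr.
- by move=> *; rewrite scalerDl.
- by move=> *; rewrite scalerDr !scalerAl.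
- by move=> *; rewrite !kriz_piE scalerDr !scalerAr.
- by move=> *; rewrite addr0.
- by move=> *; rewrite scaler0.
- by move=> *; rewrite mul0r mulr0 addr0.
- by move=> *; rewrite !mul0r !mulr0 addr0 scaler0.
- move=> l i j ij k x xk.
  rewrite !mul0r mulr0 add0r addr0 !kriz_piE (parity_gr xk) linearZ -scalerAl.
  by rewrite kriz_diag_pC.
- move=> i j ij k l kl; rewrite !kriz_piE !mulNr !kriz_diag_GC.
  by rewrite opprD opprK addrC.
- by move=> i j ij; rewrite !kriz_piE mulNr kriz_diag_GC subrr.
- by move=> i j ij ji; rewrite kriz_diag_sym.
- by move=> i j ij x lt; rewrite !mul0r !add0r kriz_diag_coef.
- move=> i j k ij jk ik lt lt'; rewrite !kriz_piE !mulNr -!kriz_diag_GC.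
  rewrite (kriz_diag_G i jk) (kriz_diag_G j ik) (kriz_diag_sym ij).
  rewrite -(kriz_diag_sym jk) (kriz_diag_G k ij) (kriz_diag_sym ik).
  by rewrite opprB addrA subrK.
Qed.

Lemma kriz_d_pi t : kriz_d (pi t) = kriz_d_term t.
Proof. exact/kriz_d_rel/repr_rel. Qed.

Fact kriz_d_linear : linear kriz_d.
Proof.
move=> c; elim/kriz_ind=> t; elim/kriz_ind=> u.
have -> : c *: pi t + pi u = pi (kD (kZ c t) u) by rewrite !kriz_piE.
by rewrite !kriz_d_pi.
Qed.
HB.instance Definition _ :=
  GRing.isLinear.Build rat kriz kriz _ kriz_d kriz_d_linear.

Lemma kriz_d_p i x : kriz_d (kriz_p i x) = 0.
Proof. exact: kriz_d_pi. Qed.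

Lemma kriz_d_G i j (ij : i != j) : kriz_d (kriz_G ij) = kriz_diag i j.
Proof. exact: kriz_d_pi. Qed.

Lemma kriz_d_1 : kriz_d 1 = 0.
Proof. by rewrite -kriz_piE kriz_d_pi. Qed.

Definition kriz_parity (a : kriz) : kriz := kriz_parity_term (repr a).

Lemma kriz_parity_pi t : kriz_parity (pi t) = kriz_parity_term t.
Proof. exact/kriz_parity_rel/repr_rel. Qed.

Lemma kriz_dM_parity a b :
  kriz_d (a * b) = kriz_d a * b + kriz_parity a * kriz_d b.
Proof.
elim/kriz_ind: a => t; elim/kriz_ind: b => u.
by rewrite -kriz_piE !kriz_d_pi kriz_parity_pi.
Qed.

Fact kriz_parity_linear : linear kriz_parity.
Proof.
move=> c; elim/kriz_ind=> t; elim/kriz_ind=> u.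
have -> : c *: pi t + pi u = pi (kD (kZ c t) u) by rewrite !kriz_piE.
by rewrite !kriz_parity_pi.
Qed.
HB.instance Definition _ :=
  GRing.isLinear.Build rat kriz kriz _ kriz_parity kriz_parity_linear.

Fact kriz_parity_monoid : monoid_morphism kriz_parity.
Proof.
split=> [|]; first by rewrite -kriz_piE kriz_parity_pi /= kriz_piE.
elim/kriz_ind=> t; elim/kriz_ind=> u.
by rewrite -kriz_piE !kriz_parity_pi.
Qed.
HB.instance Definition _ :=
  GRing.isMonoidMorphism.Build kriz kriz kriz_parity kriz_parity_monoid.

Lemma kriz_parity_bideg q k a : (0 < m)%N -> kriz_bideg q k a ->
  kriz_parity a = (-1) ^+ k *: a.
Proof.
move=> m_gt0; elim=> {q k a} [q k|q k a b _ IHa _ IHb|q k c a _ IHa|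
  |q q' k k' a b _ IHa _ IHb|i k x xk|i j ij].
- by rewrite linear0 scaler0.
- by rewrite linearD /= IHa IHb scalerDr.
- by rewrite linearZ /= IHa !scalerA mulrC.
- by rewrite rmorph1 scale1r.
- by rewrite rmorphM /= IHa IHb -scalerAl -scalerAr scalerA exprD.
- by rewrite kriz_parity_pi /= (parity_gr xk) linearZ.
- rewrite kriz_parity_pi /= -signr_odd oddB ?muln_gt0 // oddM /=.
  by rewrite scaleN1r.
Qed.

Lemma kriz_dM q k a b : (0 < m)%N -> kriz_bideg q k a ->
  kriz_d (a * b) = kriz_d a * b + (-1) ^+ k *: (a * kriz_d b).
Proof.
move=> m_gt0 ha.
by rewrite kriz_dM_parity (kriz_parity_bideg m_gt0 ha) scalerAl.
Qed.

Lemma kriz_diag_bideg i j : kriz_bideg 0 (2 * m) (kriz_diag i j).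
Proof.
have -> : kriz_diag i j = \sum_(k < (2 * m).+1) \sum_a (-1 : rat) ^+ k *:
    (kriz_p i (coh_proj H k (coh_basis a)) *
     kriz_p j (coh_proj H (rev_ord k) (@coh_dual m H a))).
  transitivity (\sum_(k < (2 * m).+1) \sum_a (-1 : rat) ^+ k *:
    (kriz_p i (coh_proj H k (coh_basis a)) * kriz_p j (@coh_dual m H a))).
    rewrite exchange_big; apply: eq_bigr => a _.
    rewrite /coh_parity linear_sum mulr_suml; apply: eq_bigr => k _.
    by rewrite linearZ -scalerAl.
  apply: eq_bigr => k _; rewrite -!scaler_sumr; congr (_ *: _).
  rewrite -(@kriz_pp_adjoint i j (coh_proj H k) (fun y => y)
    (coh_proj H k) (coh_proj H (rev_ord k))) //.
  - by apply: eq_bigr => a _; rewrite (proj_gr k (mem_proj k _)) eqxx.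
  - exact: linearP.
  - exact: int_proj.
apply: (big_ind (kriz_bideg 0 (2 * m))) => [|a b|k _].
- exact: kbideg_0.
- exact: kbideg_D.
apply: (big_ind (kriz_bideg 0 (2 * m))) => [|a b|a _].
- exact: kbideg_0.
- exact: kbideg_D.
apply: kbideg_Z; have lek : (k <= 2 * m)%N by rewrite -ltnS.
have : kriz_bideg (0 + 0) (k + rev_ord k)
    (kriz_p i (coh_proj H k (coh_basis a)) *
     kriz_p j (coh_proj H (rev_ord k) (@coh_dual m H a))).
  by apply: kbideg_M; apply: kbideg_p; apply: mem_proj.
by rewrite [X in kriz_bideg _ X]/= subSS subnKC.
Qed.

Lemma kriz_d_bideg q k a : (0 < m)%N -> kriz_bideg q k a ->
  (q = 0%N -> kriz_d a = 0) /\ kriz_bideg q.-1 k.+1 (kriz_d a).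
Proof.
move=> m_gt0; elim=> {q k a} [q k|q k a b _ [Za IHa] _ [Zb IHb]|
  q k c a _ [Za IHa]||q q' k k' a b ha [Za IHa] hb [Zb IHb]|i k x xk|i j ij].
- by rewrite linear0; split=> //; apply: kbideg_0.
- rewrite linearD /=; split=> [q0|]; first by rewrite Za // Zb // addr0.
  exact: kbideg_D.
- rewrite linearZ /=; split=> [q0|]; first by rewrite Za // scaler0.
  exact: kbideg_Z.
- by rewrite kriz_d_1; split=> //; apply: kbideg_0.
- rewrite (kriz_dM _ m_gt0 ha); split=> [/eqP|].
    rewrite addn_eq0 => /andP[/eqP q0 /eqP q'0].
    by rewrite Za // Zb // mul0r mulr0 scaler0 addr0.
  apply: kbideg_D.
    case: q Za IHa {ha} => [Za _|q _ IHa].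
      by rewrite Za // mul0r; apply: kbideg_0.
    by rewrite addSn /= -addSn; apply: kbideg_M.
  apply: kbideg_Z; case: q' Zb IHb {hb} => [Zb _|q' _ IHb].
    by rewrite Zb // mulr0; apply: kbideg_0.
  by rewrite addnS /= -addnS; apply: kbideg_M.
- by rewrite kriz_d_p; split=> //; apply: kbideg_0.
- rewrite kriz_d_G; split=> //=.
  by rewrite subn1 prednK ?muln_gt0 //; apply: kriz_diag_bideg.
Qed.

End KrizModel.

(* Main.v *)
(* Number the points 0, ..., n - 1. By the Arnold relation, E_{n-1} is spanned
   by the p_0(x) G_T, where T is a tree in which every vertex k > 0 is joined to
   exactly one smaller vertex; such a tree contains the edge 01. For a set B of
   points that contains 1 but not 0, collapse the factors in B to one copy of
   H^*(X), kill the G_ij that cross B, and integrate over that copy of H^*(X).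
   Applied to d(G_01 p_0(x) G_T'), this leaves p_0(x) G_T' if B is the component
   of 1 in T' = T - 01, and 0 otherwise: all terms but the one that differentiates
   G_01 contain the crossing edge 01, and the integral of the diagonal class over
   one factor is 1. Summing over B and multiplying by G_01 thus inverts d. *)
Require Import Defs.
From HB Require Import structures.
From mathcomp Require Import all_boot all_order all_algebra all_field.
From mathcomp Require Import boolp.

Set Implicit Arguments.
Unset Strict Implicit.
Unset Printing Implicit Defensive.

Import GRing.Theory.
Local Open Scope ring_scope.
Local Open Scope quotient_scope.

(** * Collapsing the points of [B] to a single factor of cohomology *)

Section Action.
Context (m : nat) (H : poincareAlg m) (n : nat) (B : {set 'I_n}).
Local Notation E := (kriz H n).
Local Notation par := (@coh_parity m H).
Implicit Types (f g : H -> E) (t u : kriz_term H n).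

(* The algebra map E -> E (x) H that sends p_i(x) to 1 (x) x when i is in B,
   keeps p_i(x) otherwise, keeps G_ij when B does not separate i from j, and
   kills it otherwise. The graded tensor product E (x) H is seen as Hom(H, E)
   through Poincare duality; the iterated parity is the Koszul sign. *)
Fixpoint block_act t f : H -> E :=
  match t with
  | k0 => fun=> 0
  | k1 => f
  | kN t => fun z => - block_act t f z
  | kD t u => fun z => block_act t f z + block_act u f z
  | kZ c t => fun z => c *: block_act t f z
  | kM t u => block_act t (block_act u f)
  | kP i x => if i \in B then fun z => f (z * x)
      else fun z => \sum_(k < (2 * m).+1)
        kriz_p i (coh_proj H k x) * f (iter k par z)
  | kG i j ij => if (i \in B) == (j \in B) then fun z => kriz_G H ij * f (par z)
      else fun=> 0
  end.

Lemma block_act_linear t f : linear f -> linear (block_act t f).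
Proof.
elim: t f => [||t IH|t IHt u IHu|b t IH|t IHt u IHu|i x|i j ij] f lf c y z //=.
- by rewrite scaler0 addr0.
- exact: lf.
- by rewrite IH // opprD scalerN.
- by rewrite IHt // IHu // scalerDr addrACA.
- by rewrite IH // scalerDr !scalerA mulrC.
- by apply: IHt => //; apply: IHu.
- case: ifP => _; first by rewrite mulrDl -scalerAl lf.
  rewrite scaler_sumr -big_split; apply: eq_bigr => k _ /=.
  by rewrite linearP lf mulrDr -scalerAr.
- case: ifP => _; last by rewrite scaler0 addr0.
  by rewrite linearP lf mulrDr -scalerAr.
Qed.

(** In a product the outer factor acts on the function returned by the inner one, so right
    distributivity and [krel_ZMr] call for linearity in [f], not only in [z]. *)
Lemma block_actP t c f g z : block_act t (fun y => c *: f y + g y) z =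
  c *: block_act t f z + block_act t g z.
Proof.
elim: t f g z => [||t IH|t IHt u IHu|b t IH|t IHt u IHu|i x|i j ij] f g z //=.
- by rewrite scaler0 addr0.
- by rewrite IH // opprD scalerN.
- by rewrite IHt // IHu // scalerDr addrACA.
- by rewrite IH // scalerDr !scalerA mulrC.
- by rewrite -IHt; congr (block_act t _ z); apply/funext => y; apply: IHu.
- case: ifP => _ //.
  rewrite scaler_sumr -big_split; apply: eq_bigr => k _ /=.
  by rewrite mulrDr -scalerAr.
- case: ifP => _; last by rewrite scaler0 addr0.
  by rewrite mulrDr -scalerAr.
Qed.

Lemma block_actZ t c f z : block_act t (fun y => c *: f y) z =
  c *: block_act t f z.
Proof.
have act0 : block_act t (fun=> 0) z = 0.
  have := block_actP t (-1) (fun=> 0) (fun=> 0) z.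
  have -> : (fun y : H => -1 *: (0 : E) + 0) = fun=> 0.
    by apply/funext => y; rewrite scaler0 addr0.
  by rewrite scaleN1r addNr.
have := block_actP t c f (fun=> 0) z; rewrite act0 addr0 => <-.
by congr (block_act t _ z); apply/funext => y; rewrite addr0.
Qed.

Lemma block_actD t f g z : block_act t (fun y => f y + g y) z =
  block_act t f z + block_act t g z.
Proof.
have := block_actP t 1 f g z; rewrite scale1r => <-.
by congr (block_act t _ z); apply/funext => y; rewrite scale1r.
Qed.

Lemma block_act_out i k x f z : i \notin B -> x \in coh_gr H k ->
  block_act (kP i x) f z = kriz_p i x * f (iter k par z).
Proof.
move=> /= /negbTE-> xk.
have [k_le|k_gt] := ltnP k (2 * m).+1; last first.
  move: xk; rewrite coh_gr_gt // memv0 => /eqP->.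
  by rewrite big1 ?linear0 ?mul0r // => j _; rewrite !linear0 mul0r.
rewrite (bigD1 (Ordinal k_le)) //= (proj_gr _ xk) eqxx big1 ?addr0 // => j ne.
rewrite (proj_gr _ xk) (_ : (_ == _) = false) ?linear0 ?mul0r //.
exact: negbTE.
Qed.

Lemma block_act_outD i x y f z : i \notin B ->
  block_act (kP i (x + y)) f z = block_act (kP i x) f z + block_act (kP i y) f z.
Proof.
move=> /negbTE iB; rewrite /= iB -big_split /=.
by apply: eq_bigr => k _; rewrite !linearD mulrDl.
Qed.

(** For [i] in [B] the generator [kP i x] acts inside the argument of [f], so sums, scalars and
    signs can be pulled out only when [f] is linear. *)
Lemma block_act_rel t u : kriz_rel t u ->
  forall f, linear f -> forall z, block_act t f z = block_act u f z.
Proof.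
have l0 f : linear f -> f 0 = 0.
  by move=> lf; have := lf (-1) 0 0; rewrite scaler0 addr0 scaleN1r addNr.
have lD f x y : linear f -> f (x + y) = f x + f y.
  by move=> lf; have := lf 1 x y; rewrite !scale1r.
have lZ f c x : linear f -> f (c *: x) = c *: f x.
  by move=> lf; have := lf c x 0; rewrite l0 // !addr0.
have parZ f k x z : linear f -> x \in coh_gr H k ->
    f (par (z * x)) = (-1) ^+ k *: f (par z * x).
  by move=> lf xk; rewrite parityM (parity_gr xk) -scalerAr lZ.
have iterM f l k x z : linear f -> x \in coh_gr H k ->
    f (iter l par (z * x)) = (-1) ^+ (l * k) *: f (iter l par z * x).
  by move=> lf xk; rewrite epsM (eps_gr l xk) -scalerAr lZ.
have actM v w f : block_act (kM v w) f = block_act v (block_act w f) by [].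
have actS c v f z : block_act (kZ c v) f z = c *: block_act v f z by [].
have actI i x f z : i \in B -> block_act (kP i x) f z = f (z * x) by move=> /= ->.
elim=> {t u}.
- by [].
- by move=> t u _ IH f lf z; rewrite IH.
- by move=> t u v _ IH1 _ IH2 f lf z; rewrite IH1 // IH2.
- by move=> t t' _ IH f lf z /=; rewrite IH.
- by move=> t t' u u' _ IH _ IH' f lf z /=; rewrite IH // IH'.
- by move=> c t t' _ IH f lf z /=; rewrite IH.
- move=> t t' u u' _ IH _ IH' f lf z /=.
  by rewrite (funext (IH' f lf)) IH //; apply: block_act_linear.
- by move=> t u v f lf z /=; rewrite addrA.
- by move=> t u f lf z /=; rewrite addrC.
- by move=> t f lf z /=; rewrite add0r.
- by move=> t f lf z /=; rewrite addNr.
- by [].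
- by [].
- by [].
- by [].
- by move=> t u v f lf z /=; rewrite block_actD.
- by move=> b c t f lf z /=; rewrite scalerA.
- by move=> t f lf z /=; rewrite scale1r.
- by move=> c t u f lf z /=; rewrite scalerDr.
- by move=> b c t f lf z /=; rewrite scalerDl.
- by [].
- by move=> c t u f lf z /=; rewrite block_actZ.
- move=> i x y f lf z /=; case: ifP => _; first by rewrite mulrDr lD.
  by rewrite -big_split; apply: eq_bigr => k _; rewrite !linearD mulrDl.
- move=> c i x f lf z /=; case: ifP => _; first by rewrite -scalerAr lZ.
  by rewrite scaler_sumr; apply: eq_bigr => k _; rewrite !linearZ -scalerAl.
- move=> i f lf z; case iB: (i \in B); first by rewrite /= iB mulr1.
  rewrite (block_act_out _ _ _ (mem_1 H)) ?iB //=.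
  by rewrite (kriz_p_monoid H i).1 mul1r.
- move=> i x y f lf z; case iB: (i \in B); first by rewrite /= iB mulrA.
  have outD x' y' g z' : block_act (kP i (x' + y')) g z' =
      block_act (kP i x') g z' + block_act (kP i y') g z'.
    by rewrite block_act_outD ?iB.
  move: x; apply: gr_ind => [x x' hx hx'|k x xk].
    rewrite mulrDl outD hx hx' [RHS]/=; exact/esym/outD.
  move: y; apply: gr_ind => [y y' hy hy'|l y yl].
    rewrite mulrDr outD hy hy'.
    transitivity (block_act (kP i x)
      (fun z' => block_act (kP i y) f z' + block_act (kP i y') f z') z).
      exact/esym/block_actD.
    by rewrite actM; congr (block_act _ _ _); apply/funext => z'; apply/esym/outD.
  rewrite (block_act_out _ _ _ (coh_mul_gr xk yl)) ?iB //.
  rewrite actM (block_act_out _ _ _ xk) ?iB // (block_act_out _ _ _ yl) ?iB //.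
  by rewrite rmorphM mulrA addnC iterD.
- move=> i j k l x y ij xk yl f lf z; rewrite actS !actM.
  case iB: (i \in B); case jB: (j \in B).
  + by rewrite !actI // -mulrA (coh_mulC xk yl) -scalerAr lZ // mulrA.
  + rewrite !(actI i) // !(block_act_out _ _ _ yl) ?jB // (actI i) //.
    by rewrite (iterM _ _ _ _ _ _ xk) // -scalerAr mulnC.
  + rewrite !(block_act_out _ _ _ xk) ?iB // !(actI j) //.
    rewrite (block_act_out _ _ _ xk) ?iB //.
    rewrite (iterM _ _ _ _ _ _ yl) // -scalerAr scalerA -exprD addnn -mul2n.
    by rewrite exprM sqrrN !expr1n scale1r.
  + rewrite !(block_act_out _ _ _ xk) ?iB // !(block_act_out _ _ _ yl) ?jB //.
    rewrite !(block_act_out _ _ _ xk) ?iB // !mulrA (kriz_pC ij xk yl) -scalerAl.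
    by rewrite -!iterD addnC.
- move=> l i j ij k x xk f lf z; rewrite actS !actM.
  case lB: (l \in B).
    rewrite actI //=; case: ifP => _; last by rewrite scaler0.
    by rewrite lB (parZ _ _ _ _ _ xk) // scalerAr.
  rewrite (block_act_out _ _ _ xk) ?lB //=; case: ifP => _; last first.
    by rewrite mulr0 scaler0.
  have := block_act_out f (par z) (negbT lB) xk; rewrite /= lB => ->.
  by rewrite !mulrA (kriz_pGC _ _ xk) -scalerAl -iterSr.
- move=> i j ij k l kl f lf z /=.
  case: (_ == (j \in B)); case: (_ == (l \in B)); rewrite ?mulr0 ?oppr0 //.
  by rewrite !mulrA kriz_GC mulNr.
- move=> i j ij f lf z /=; case: (_ == _); rewrite ?mulr0 //.
  by rewrite !mulrA kriz_G2 mul0r.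
- by move=> i j ij ji f lf z /=; rewrite eq_sym (kriz_G_sym H ij ji).
- move=> i j ij x lt f lf z /=.
  have [->|_] := eqVneq (i \in B) (j \in B); last first.
    by do 2 case: ifP => _ //; rewrite !big1 // => k _; rewrite mulr0.
  case: ifP => _ //; apply: eq_bigr => k _.
  by rewrite !mulrA kriz_coef.
(* If [B] contains one or two of the three points, two sides of the triangle cross it, and any
   product of two sides contains one of these: all terms vanish. *)
- move=> i j k ij jk ik lt lt' f lf z /=.
  case: (i \in B); case: (j \in B); case: (k \in B) => /=;
    rewrite ?mulr0 ?oppr0 ?addr0 //.
  all: by rewrite !mulrA (kriz_arnold _ ij) // mulrBl.
Qed.

End Action.

(** * Integration over the collapsed factor *)

Section BlockIntegral.
Context (m : nat) (H : poincareAlg m) (n : nat) (B : {set 'I_n}).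
Local Notation E := (kriz H n).
Local Notation par := (@coh_parity m H).
Local Notation pi := (\pi_(kriz H n)).

(* [block_act] followed by the integral on the factor H. *)
Definition block_int (a : E) : E :=
  block_act B (repr a) (fun z => coh_int z *: 1) 1.

Fact int1_linear : linear (fun z : H => coh_int z *: (1 : E)).
Proof. by move=> c x y; rewrite linearP scalerDl scalerA. Qed.

Lemma block_int_pi t : block_int (pi t) = block_act B t (fun z => coh_int z *: 1) 1.
Proof. exact/block_act_rel/int1_linear/repr_rel. Qed.

Fact block_int_linear : linear block_int.
Proof.
move=> c; elim/kriz_ind=> t; elim/kriz_ind=> u.
have -> : c *: pi t + pi u = pi (kD (kZ c t) u) by rewrite !kriz_piE.
by rewrite !block_int_pi.
Qed.
HB.instance Definition _ :=
  GRing.isLinear.Build rat E E _ block_int block_int_linear.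

Lemma block_int_pM i x (a : E) : i \notin B ->
  block_int (kriz_p i x * a) = kriz_p i x * block_int a.
Proof.
move=> iB; move: x; apply: gr_ind => [x y hx hy|k x xk].
  by rewrite linearD mulrDl linearD /= hx hy -mulrDl.
elim/kriz_ind: a => t; rewrite -!kriz_piE !block_int_pi.
transitivity (block_act B (kP i x) (block_act B t (fun z => coh_int z *: 1)) 1).
  by [].
rewrite (block_act_out _ _ iB xk) kriz_piE; congr (_ * block_act _ _ _ _).
(* The evaluation point 1 is even, so pulling out [kriz_p i x] costs no sign. *)
by elim: k {xk} => //= k ->; rewrite parity1.
Qed.

Lemma block_int_GM i j (ij : i != j) (a : E) :
  block_int (kriz_G H ij * a) =
  if (i \in B) == (j \in B) then kriz_G H ij * block_int a else 0.
Proof.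
elim/kriz_ind: a => t; rewrite -!kriz_piE !block_int_pi /= kriz_piE.
by case: ifP; rewrite ?parity1.
Qed.

Lemma block_int_p i x : i \in B -> block_int (kriz_p i x) = coh_int x *: 1.
Proof. by move=> iB; rewrite -kriz_piE block_int_pi /= iB mul1r. Qed.

(** The integrals of the dual basis are the coordinates of 1 in the basis, so integrating out the
    factor at [j] leaves [kriz_p i] of the parity of 1. *)
Lemma block_int_diag i j : i \notin B -> j \in B ->
  block_int (kriz_diag H i j) = 1.
Proof.
move=> iB jB; rewrite linear_sum /=.
under eq_bigr => a _ do
  rewrite block_int_pM // block_int_p // -scalerAr mulr1 -linearZ /= -linearZ /=.
rewrite -!linear_sum /=; transitivity (kriz_p i (1 : H)).
  rewrite -[in RHS](@parity1 m H) [in RHS](basis_expand (1 : H)).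
  by do 2 congr (_ _); apply: eq_bigr => a _; rewrite mul1r.
exact: (kriz_p_monoid H i).1.
Qed.

End BlockIntegral.

(** * Spanning the model by decreasing forests *)

Section Monomials.
Context (m : nat) (H : poincareAlg m) (n : nat).
Local Notation E := (kriz H n).
Local Notation par := (@coh_parity m H).
Implicit Types (a b i j k l : 'I_n) (s : seq ('I_n * H)) (T : seq ('I_n * 'I_n)).

Fact neq_ordP i j : i <> j -> i != j.
Proof. by move/eqP. Qed.

(* [G_ij], with the junk value [0] when [i = j]. *)
Definition kriz_edge i j : E :=
  if @eqP _ i j is ReflectF ij then kriz_G H (neq_ordP ij) else 0.

Lemma kriz_edgeE i j (ij : i != j) : kriz_edge i j = kriz_G H ij.
Proof.
rewrite /kriz_edge; case: eqP => [/eqP e|ne]; first by rewrite (negbTE ij) in e.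
by rewrite (bool_irrelevance (neq_ordP ne) ij).
Qed.

Lemma kriz_edge_lt i j (ij : (i < j)%N) :
  {ne : i != j | kriz_edge i j = kriz_G H ne}.
Proof.
have ne : i != j by apply: contraTneq ij => ->; rewrite ltnn.
by exists ne; apply: kriz_edgeE.
Qed.

Lemma kriz_pE l x i j : kriz_p l x * kriz_edge i j = kriz_edge i j * kriz_p l (par x).
Proof.
by rewrite /kriz_edge; case: eqP => [_|ij]; rewrite ?kriz_pG ?mulr0 ?mul0r.
Qed.

Lemma kriz_edgeC i j k l :
  kriz_edge i j * kriz_edge k l = - (kriz_edge k l * kriz_edge i j).
Proof.
rewrite /kriz_edge; case: eqP => [_|ij]; case: eqP => [_|kl];
  rewrite ?mulr0 ?mul0r ?oppr0 //; exact: kriz_GC.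
Qed.

Lemma kriz_edge2 i j : kriz_edge i j * kriz_edge i j = 0.
Proof. by rewrite /kriz_edge; case: eqP => [_|ij]; rewrite ?kriz_G2 ?mul0r. Qed.

Lemma kriz_edge_coef i j x :
  kriz_p j x * kriz_edge i j = kriz_p i x * kriz_edge i j.
Proof.
by rewrite /kriz_edge; case: eqP => [_|ij]; rewrite ?mulr0 ?kriz_coef_all.
Qed.

Lemma kriz_edge_arnold i j k : (i < j)%N -> (j < k)%N ->
  kriz_edge i k * kriz_edge j k =
  kriz_edge i j * kriz_edge j k - kriz_edge i j * kriz_edge i k.
Proof.
move=> ij jk.
have [? ->] := kriz_edge_lt ij; have [? ->] := kriz_edge_lt jk.
have [? ->] := kriz_edge_lt (ltn_trans ij jk).
exact: kriz_arnold.
Qed.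

Definition kriz_pprod s : E := \prod_(c <- s) kriz_p c.1 c.2.
Definition kriz_mono T : E := \prod_(e <- T) kriz_edge e.1 e.2.

Lemma kriz_mono_cons e T :
  kriz_mono (e :: T) = kriz_edge e.1 e.2 * kriz_mono T.
Proof. exact: big_cons. Qed.

(** These are the standard monomials for the Arnold relation: each vertex is joined to at most one
    smaller vertex, which excludes cycles. The bound [N] leaves room for an edge with a larger upper
    end in front. *)
Fixpoint decr_forest N T : bool :=
  if T is e :: T' then [&& (e.1 < e.2)%N, (e.2 < N)%N & decr_forest e.2 T']
  else true.

Inductive forest_span N q : E -> Prop :=
  | fspan0 : forest_span N q 0
  | fspanD u v : forest_span N q u -> forest_span N q v -> forest_span N q (u + v)
  | fspan_mono c s T : decr_forest N T -> size T = q ->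
      forest_span N q (c *: (kriz_pprod s * kriz_mono T)).

Lemma fspanZ N q c u : forest_span N q u -> forest_span N q (c *: u).
Proof.
elim=> {u} [|u v _ IHu _ IHv|c' s T dT sT].
- by rewrite scaler0; apply: fspan0.
- by rewrite scalerDr; apply: fspanD.
- by rewrite scalerA; apply: fspan_mono.
Qed.

Lemma fspanB N q u v :
  forest_span N q u -> forest_span N q v -> forest_span N q (u - v).
Proof.
by move=> hu hv; apply: fspanD => //; rewrite -scaleN1r; apply: fspanZ.
Qed.

Lemma fspan_p N q l x u :
  forest_span N q u -> forest_span N q (kriz_p l x * u).
Proof.
elim=> {u} [|u v _ IHu _ IHv|c s T dT sT].
- by rewrite mulr0; apply: fspan0.
- by rewrite mulrDr; apply: fspanD.
- rewrite -scalerAr mulrA (_ : _ * kriz_pprod s = kriz_pprod ((l, x) :: s)).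
    exact: fspan_mono.
  by rewrite /kriz_pprod big_cons.
Qed.

Lemma kriz_edge_pprod i j s : kriz_edge i j * kriz_pprod s =
  kriz_pprod [seq (c.1, par c.2) | c <- s] * kriz_edge i j.
Proof.
elim: s => [|c s IH]; first by rewrite /kriz_pprod !big_nil mulr1 mul1r.
rewrite /kriz_pprod /= !big_cons -/(kriz_pprod _) -/(kriz_pprod s) /= -mulrA.
by rewrite -IH !mulrA; congr (_ * _); rewrite kriz_pE parityK.
Qed.

Lemma fspan_cons N q i j u : (i < j)%N -> (j < N)%N ->
  forest_span j q u -> forest_span N q.+1 (kriz_edge i j * u).
Proof.
move=> ij jN; elim=> {u} [|u v _ IHu _ IHv|c s T dT sT].
- by rewrite mulr0; apply: fspan0.
- by rewrite mulrDr; apply: fspanD.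
- rewrite -scalerAr mulrA kriz_edge_pprod -mulrA.
  rewrite -(kriz_mono_cons (i, j)); apply: fspan_mono => /=; last by rewrite sT.
  by rewrite ij jN.
Qed.

Lemma fspan_mono1 N T : decr_forest N T -> forest_span N (size T) (kriz_mono T).
Proof.
move=> dT; have := fspan_mono 1 [::] dT (erefl _).
by rewrite /kriz_pprod big_nil mul1r scale1r.
Qed.

(* An edge is pushed past the edges with a larger upper end; against one with
   the same upper end, the Arnold relation trades it for an edge with a smaller
   upper end. *)
Lemma fspan_edge_mono N T a b : (a < b)%N -> (b < N)%N -> decr_forest N T ->
  forest_span N (size T).+1 (kriz_edge a b * kriz_mono T).
Proof.
elim: T N a b => [|[i j] T IH] N a b ab bN dT.
  by apply: fspan_cons => //; apply: (@fspan_mono1 _ [::]).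
have [bj|jb|/val_inj ej] := ltngtP b j; last first.
- subst b; case/and3P: dT => /= ij jN dT; rewrite kriz_mono_cons mulrA /=.
  have [ai|ia|/val_inj->] := ltngtP a i.
  (* Both resulting terms have an edge with upper end [j] in front and the edge from [a] to [i]
     behind it; as [i < j], the induction hypothesis absorbs the latter into [T]. *)
  + rewrite kriz_edge_arnold // [X in X - _]kriz_edgeC [X in _ - X]kriz_edgeC.
    rewrite opprK addrC mulrBl -!mulrA; apply: fspanB; apply: fspan_cons => //;
      exact: IH.
  + rewrite kriz_edgeC kriz_edge_arnold // opprB mulrBl.
    rewrite [X in X * _ - _]kriz_edgeC [X in _ - X * _]kriz_edgeC -mulrBl opprK.
    rewrite addrC mulrBl -!mulrA; apply: fspanB; apply: fspan_cons => //;
      exact: IH.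
  + by rewrite kriz_edge2 mul0r; apply: fspan0.
- apply: fspan_cons => //; apply: fspan_mono1.
  by move: dT; rewrite /= jb => /and3P[-> _ ->].
- case/and3P: dT => /= ij jN dT; rewrite kriz_mono_cons mulrA kriz_edgeC /=.
  rewrite mulNr -mulrA -scaleN1r; apply/fspanZ/fspan_cons => //.
  exact: IH.
Qed.

Lemma fspan_edge N q a b u : (a < b)%N -> (b < N)%N ->
  forest_span N q u -> forest_span N q.+1 (kriz_edge a b * u).
Proof.
move=> ab bN; elim=> {u} [|u v _ IHu _ IHv|c s T dT <-].
- by rewrite mulr0; apply: fspan0.
- by rewrite mulrDr; apply: fspanD.
- rewrite -scalerAr mulrA kriz_edge_pprod -mulrA; apply: fspanZ.
  rewrite /kriz_pprod; elim: [seq _ | _ <- s] => [|e s' IH].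
    by rewrite big_nil mul1r; apply: fspan_edge_mono.
  by rewrite big_cons -mulrA; apply: fspan_p.
Qed.

Lemma kriz_bideg_span (q k : nat) (u : E) : kriz_bideg q k u -> forest_span n q u.
Proof.
(* A product of two spanned elements is not visibly spanned, so the induction treats multiplication
   by [a] as an operator on the span; applying it to 1, the empty forest, gives the claim. *)
move: u; suff spanM (a : E) : kriz_bideg q k a ->
    forall q' u, forest_span n q' u -> forest_span n (q + q') (a * u).
  move=> u /spanM/(_ 0%N 1); rewrite mulr1 addn0; apply.
  by have := @fspan_mono1 n [::] isT; rewrite /kriz_mono big_nil.
elim=> {q k a} [q k|q k a b _ IHa _ IHb|q k c a _ IHa||q q' k k' a b _ IHa _ IHb|
  i k x _|i j ij] r u hu.
- by rewrite mul0r; apply: fspan0.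
- by rewrite mulrDl; apply: fspanD; [apply: IHa|apply: IHb].
- by rewrite -scalerAl; apply/fspanZ/IHa.
- by rewrite mul1r.
- by rewrite -mulrA -addnA; apply/IHa/IHb.
- exact: fspan_p.
- rewrite -kriz_edgeE.
  have [lt|lt|/val_inj e] := ltngtP i j; last by case/eqP: (ij).
    exact: fspan_edge.
  have ji : j != i by rewrite eq_sym.
  by rewrite kriz_edgeE (kriz_G_sym H ji ij) -kriz_edgeE; apply: fspan_edge.
Qed.

End Monomials.

(** * Decreasing trees and the left inverse of the differential *)

Section Trees.
Context (m : nat) (H : poincareAlg m) (n : nat).
Local Notation E := (kriz H n.+2).
Local Notation par := (@coh_parity m H).
Local Notation v0 := (ord0 : 'I_n.+2).
Local Notation v1 := (lift ord0 ord0 : 'I_n.+2).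
Local Notation edge := (@kriz_edge m H n.+2).
Local Notation mono := (@kriz_mono m H n.+2).
Implicit Types (i j k l : 'I_n.+2) (B : {set 'I_n.+2}).
Implicit Types (s : seq ('I_n.+2 * H)) (T : seq ('I_n.+2 * 'I_n.+2)).

Lemma decr_forest_size N T : (0 < N)%N -> decr_forest N T -> (size T < N)%N.
Proof.
elim: T N => //= e T IH N _ /and3P[lt eN /IH].
move=> /(_ (leq_ltn_trans (leq0n _) lt)) leT; exact: leq_ltn_trans leT eN.
Qed.

(** The maximal number of edges leaves no gap between upper ends: the first edge attaches the
    largest vertex, as a leaf, to a tree on the others. *)
Lemma decr_tree_cons N i j T :
  decr_forest N ((i, j) :: T) -> (size T).+2 = N ->
  [/\ (i < j)%N, (j.+1 = N)%N, decr_forest j T & (size T).+1 = j].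
Proof.
move=> /= /and3P[ij jN dT] sN; rewrite ij dT.
have sT : (size T < j)%N := decr_forest_size (leq_ltn_trans (leq0n _) ij) dT.
suff -> : nat_of_ord j = (size T).+1 by [].
by apply/eqP; rewrite eqn_leq sT andbT -ltnS sN.
Qed.

(** A tree is connected, so [kriz_edge_coef] carries a coefficient edge by edge down to vertex 0. *)
Lemma kriz_p_tree N T l x :
  decr_forest N T -> (size T).+1 = N -> (l < N)%N ->
  kriz_p l x * mono T = kriz_p v0 x * mono T.
Proof.
elim: T N l x => [|[i j] T IH] N l x.
  by move=> _ <-; rewrite ltnS leqn0 => /eqP/(@val_inj _ _ _ l v0)->.
move=> dT sN lN; have [ij jN dT' sj] := decr_tree_cons dT sN.
have lt_root k : (k < j)%N ->
    kriz_p k x * mono ((i, j) :: T) = kriz_p v0 x * mono ((i, j) :: T).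
  move=> kj; rewrite kriz_mono_cons !mulrA !kriz_pE -!mulrA.
  by rewrite (IH _ _ _ dT' sj kj).
move: lN; rewrite -jN ltnS leq_eqVlt => /orP[/eqP/val_inj->|]; last exact: lt_root.
(* The leaf [j] hands its coefficient to its parent [i], a case already settled. *)
rewrite -(lt_root _ ij) kriz_mono_cons !mulrA; congr (_ * _).
exact: kriz_edge_coef.
Qed.

Lemma kriz_p_mono l x T :
  kriz_p l x * mono T = mono T * kriz_p l (iter (size T) par x).
Proof.
elim: T x => [|e T IH] x; first by rewrite /kriz_mono big_nil mulr1 mul1r.
by rewrite kriz_mono_cons mulrA kriz_pE -mulrA IH mulrA -iterSr.
Qed.

Lemma kriz_pprod_tree s T : decr_forest n.+2 T -> size T = n.+1 ->
  kriz_pprod s * mono T = kriz_p v0 (\prod_(c <- s) c.2) * mono T.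
Proof.
move=> dT sT; elim: s => [|c s IH].
  by rewrite /kriz_pprod !big_nil (kriz_p_monoid H v0).1.
rewrite /kriz_pprod !big_cons -/(kriz_pprod s) -mulrA IH.
(* The coefficient already at 0 is parked to the right of the tree while the next one slides down,
   then brought back. *)
rewrite [X in _ * X]kriz_p_mono mulrA (kriz_p_tree _ dT (congr1 S sT) (ltn_ord c.1)).
by rewrite -mulrA -[X in _ * X]kriz_p_mono mulrA -(kriz_p_monoid H v0).2.
Qed.

(** Such a [B] is a union of components of the forest; for any other, [block_int B] kills the
    monomial. *)
Definition compatible B T : bool := all (fun e => (e.1 \in B) == (e.2 \in B)) T.

(* A decreasing tree contains the edge [01]; removing it leaves a forest with
   two components, and [B] is the vertex set of the one that contains 1. *)
Lemma tree_split N T : (1 < N)%N -> decr_forest N T -> (size T).+1 = N ->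
  exists c T' B, [/\ mono T = c *: (edge v0 v1 * mono T'),
    all (fun e : 'I_n.+2 * 'I_n.+2 => (e.1 < N) && (e.2 < N))%N T',
    [/\ v0 \notin B, v1 \in B & compatible B T'] &
    forall B', v0 \notin B' -> v1 \in B' -> compatible B' T' ->
      forall l, (l < N)%N -> (l \in B') = (l \in B)].
Proof.
elim: T N => [|[i j] T IH] N N1 dT sN; first by rewrite -sN in N1.
have [ij jN dT' sj] := decr_tree_cons dT sN.
case: T IH dT sN dT' sj => [_ _ _ _ /= j1|e T IH dT sN dT' sj].
  have ej : j = v1 by apply: val_inj; rewrite /= -j1.
  have ei : i = v0.
    by apply: val_inj; move: ij; rewrite -j1 ltnS leqn0 => /eqP.
  exists 1, [::], [set v1]; split=> //.
  - by rewrite kriz_mono_cons scale1r ei ej.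
  - by rewrite !inE.
  - move=> B' /negbTE B0 B1 _ l; rewrite -jN ej ltnS leq_eqVlt inE => /orP[].
      by move=> /eqP/val_inj->; rewrite B1 eqxx.
    by rewrite ltnS leqn0 => /eqP/(@val_inj _ _ _ l v0)->; rewrite B0.
have j_gt1 : (1 < j)%N by rewrite -sj.
have [c [T' [B [eT ltT' [B0 B1 BT'] uB]]]] := IH j j_gt1 dT' sj.
have ne k : (k < j)%N -> k != j by move=> kj; apply: contraTneq kj => ->; rewrite ltnn.
(* The leaf [j] lies in the component of its parent [i]. *)
pose B' := [set k | if k == j then i \in B else k \in B].
have B'E k : (k < j)%N -> (k \in B') = (k \in B).
  by move=> kj; rewrite inE (negbTE (ne k kj)).
have jB' : (j \in B') = (i \in B) by rewrite inE eqxx.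
(* The sign comes from exchanging the anticommuting edges [ij] and 01. *)
exists (- c), ((i, j) :: T'), B'; split.
- rewrite kriz_mono_cons eT -scalerAr mulrA kriz_edgeC mulNr scalerN scaleNr.
  by rewrite -mulrA -kriz_mono_cons.
- rewrite /= -jN ltnS (ltnW ij) ltnSn /=; apply: sub_all ltT' => f /andP[lt1 lt2].
  by rewrite !ltnS (ltnW lt1) (ltnW lt2).
- rewrite !B'E ?B0 ?B1 //; last exact: ltnW; split=> //=.
  rewrite jB' B'E // eqxx /=; apply/allP => f fT'.
  have /andP[lt1 lt2] := allP ltT' _ fT'.
  by rewrite !B'E //; apply: (allP BT').
- move=> B2 B20 B21 /= /andP[/eqP ij2 BT2] l; rewrite -jN ltnS leq_eqVlt.
  have uB2 := uB B2 B20 B21 BT2.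
  case/orP=> [/eqP/val_inj->|lj]; first by rewrite jB' -ij2 uB2.
  by rewrite B'E // uB2.
Qed.

Lemma block_int_monoM B T (a : E) : block_int B (mono T * a) =
  if compatible B T then mono T * block_int B a else 0.
Proof.
elim: T => [|e T IH] /=; first by rewrite /kriz_mono big_nil !mul1r.
rewrite kriz_mono_cons -mulrA.
have [e12|ne] := eqVneq e.1 e.2.
  rewrite e12 eqxx /=.
  have -> : edge e.2 e.2 = 0 by rewrite /kriz_edge; case: eqP.
  by rewrite !mul0r linear0; case: ifP.
rewrite (kriz_edgeE _ ne) block_int_GM.
case: eqP => //= _; rewrite IH.
by case: ifP; rewrite ?mulr0 ?mulrA.
Qed.

Lemma kriz_diag_mono i j T :
  kriz_diag H i j * mono T = mono T * kriz_diag H i j.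
Proof.
elim: T => [|e T IH]; first by rewrite /kriz_mono big_nil mulr1 mul1r.
rewrite kriz_mono_cons mulrA -[RHS]mulrA -IH mulrA; congr (_ * _).
rewrite /kriz_edge; case: eqP => [_|ne]; first by rewrite mulr0 mul0r.
exact: kriz_diag_GC.
Qed.

(* A left inverse of [kriz_d] in the top exterior degree: in the differential
   of a decreasing tree, [block_int B] kills the terms that keep the edge [01],
   and the sum over [B] keeps the remaining term exactly once. *)
Definition kriz_retract (a : E) : E :=
  edge v0 v1 * \sum_(B : {set 'I_n.+2} | (v0 \notin B) && (v1 \in B)) block_int B a.

Fact kriz_retract_linear : linear kriz_retract.
Proof.
move=> c a b; rewrite /kriz_retract scalerAr -mulrDr scaler_sumr -big_split /=.
by congr (_ * _); apply: eq_bigr => B _; rewrite linearP.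
Qed.
HB.instance Definition _ :=
  GRing.isLinear.Build rat E E _ kriz_retract kriz_retract_linear.

Lemma kriz_retractK (k : nat) (a : E) :
  kriz_bideg n.+1 k a -> kriz_retract (kriz_d a) = a.
Proof.
move/kriz_bideg_span; elim=> {a} [|a b _ IHa _ IHb|c s T dT sT].
- by rewrite !linear0.
- by rewrite !linearD /= IHa IHb.
rewrite !linearZ /= kriz_pprod_tree //; congr (_ *: _).
move: (\prod_(c <- s) c.2) => x {s}.
have [//|//|c' [T' [B [-> _ [B0 B1 BT'] uB]]]] := tree_split _ dT _.
  by rewrite sT.
rewrite -scalerAr !linearZ /= mulrA kriz_pE -mulrA; congr (_ *: _).
move: (par x) => {}x.
have ne01 : v0 != v1 by [].
(* The diagonal class commutes with coefficients and edges; it is moved to the right, where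
   [block_int] reaches it last. *)
have dE : kriz_d (edge v0 v1 * (kriz_p v0 x * mono T')) =
    kriz_p v0 x * (mono T' * kriz_diag H v0 v1) -
    kriz_G H ne01 * kriz_d (kriz_p v0 x * mono T').
  rewrite kriz_edgeE kriz_dM_parity kriz_d_G mulrA kriz_diag_pC -mulrA.
  by rewrite kriz_diag_mono -(kriz_piE H _).2.2 kriz_parity_pi /= mulNr !kriz_piE.
rewrite /kriz_retract; congr (_ * _); rewrite dE.
(* For the component [B] of 1 the diagonal integrates to 1, while the term that keeps the crossing
   edge 01 dies. *)
rewrite (bigD1 B) ?B0 ?B1 //= big1 => [|B' /andP[/andP[B'0 B'1] neB]].
  rewrite linearB /= block_int_pM // block_int_monoM BT' block_int_diag //.
  by rewrite block_int_GM (negbTE B0) B1 mulr1 subr0 addr0.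
(* For another block the diagonal term survives only if no edge of [T'] crosses it, and uniqueness
   then forces the block to be [B]. *)
rewrite linearB /= block_int_pM // block_int_monoM block_int_GM.
rewrite (negbTE B'0) B'1 subr0; case: ifP; rewrite ?mulr0 // => B'T'.
case/eqP: neB; apply/setP => l; exact: uB.
Qed.

End Trees.

Theorem proposition1p3 (m : nat) (H : poincareAlg m) (n k : nat)
    (m_ge1 : (1 <= m)%N) (n_ge2 : (2 <= n)%N)
    (k_ge : ((n - 1) * (2 * m - 1) <= k)%N)
    (k_le : (k <= n * (2 * m - 1) + 1)%N) :
  forall a b : kriz H n, kriz_bideg (n - 1) k a -> kriz_bideg (n - 1) k b ->
    kriz_d a = kriz_d b -> a = b.
Proof.
case: n n_ge2 {k_ge k_le} => [|[|n]] // _ a b; rewrite subn1 /= => ha hb dab.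
by rewrite -(kriz_retractK ha) dab (kriz_retractK hb).
Qed.
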